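(* Let $(k_n)$ be a good sequence in $\mathbb{N}$ with limit function $c$. (a) For every complex Borel measure $\mu$ on $\mathbb{T}$, $$\lim_{N\to\infty}\frac1N\sum_{n=1}^N|\widehat\mu(k_n)|^2=\int_{\mathbb{T}^2}c(\lambda_1\overline{\lambda_2})\,\mathrm{d}(\mu\times\overline\mu)(\lambda_1,\lambda_2).$$ (b) The sequence $(k_n)$ is ergodic if and only if $$\lim_{N\to\infty}\frac1N\sum_{n=1}^N|\widehat\mu(k_n)|^2=\sum_{a\text{ atom of }\mu}|\mu(\{a\})|^2$$ holds for every complex Borel measure $\mu$ on $\mathbb{T}$. (c) If $(k_n)$ is ergodic and $\mu$ is a Borel probability measure on $\mathbb{T}$, then $\lim_{N\to\infty}\frac1N\sum_{n=1}^N|\widehat\mu(k_n)|^2=1$ if and only if $\mu$ is a Dirac measure.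
   Context: $\mathbb{T}$ is the unit circle in $\mathbb{C}$, $\mathbb{N}=\{1,2,\dots\}$; a subsequence (sequence in $\mathbb{N}$) $(k_n)$ is a function $k:\mathbb{N}\to\mathbb{N}$ that is strictly increasing for sufficiently large indices. $(k_n)$ is good if $c(\lambda):=\lim_{N\to\infty}\frac1N\sum_{n=1}^N\lambda^{k_n}$ exists for every $\lambda\in\mathbb{T}$; it is ergodic if it is good and $c=\mathbf{1}_{\{1\}}$, i.e. $c(1)=1$ and $c(\lambda)=0$ for $\lambda\ne1$. Complex measures are finite; $\overline\mu$ is the complex conjugate measure; $\widehat\mu(k)=\int_{\mathbb{T}}z^k\,\mathrm{d}\mu(z)$. An atom of $\mu$ is a point $a$ with $\mu(\{a\})\ne0$. *)

(* Defs.v *)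
From HB Require Import structures.
From mathcomp Require Import all_boot all_order all_algebra.
From mathcomp Require Import all_classical all_reals all_analysis.
From mathcomp Require Import measurable_realfun complex.

Set Implicit Arguments.
Unset Strict Implicit.
Unset Printing Implicit Defensive.

Import Order.TTheory GRing.Theory Num.Theory.
Import numFieldNormedType.Exports.

Local Open Scope classical_set_scope.
Local Open Scope ring_scope.
Local Open Scope complex_scope.

(* The topology of R[i] is the one given by the modulus. *)
HB.instance Definition _ (R : rcfType) := NormedModule.copy R[i] R[i]^o.

Lemma cvg_complexP (R : realType) (u : nat -> R[i]) (l : R[i]) :
  u @ \oo --> l <->
  ((fun n => complex.Re (u n)) @ \oo --> complex.Re l) /\
  ((fun n => complex.Im (u n)) @ \oo --> complex.Im l).
Proof.
have normE (z : R[i]) : `|z| = (Normc.normc z)%:C by [].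
have normcE (z : R[i]) : Normc.normc z = Num.sqrt (complex.Re z ^+ 2 + complex.Im z ^+ 2).
  by case: z.
split.
- move=> /(@cvgrPdist_lt R[i] R[i]) ul; split; apply/cvgrPdist_lt => e e0;
    have /ul : 0 < e%:C by rewrite ltcR.
  + apply: filterS => n; rewrite normE ltcR; apply: le_lt_trans.
    rewrite normcE -sqrtr_sqr.
    by case: l {ul} => a b; case: (u n) => c d /=; rewrite ler_wsqrtr// lerDl sqr_ge0.
  + apply: filterS => n; rewrite normE ltcR; apply: le_lt_trans.
    rewrite normcE -sqrtr_sqr.
    by case: l {ul} => a b; case: (u n) => c d /=; rewrite ler_wsqrtr// lerDr sqr_ge0.
- move=> [/cvgrPdist_lt uRe /cvgrPdist_lt uIm]; apply/(@cvgrPdist_lt R[i] R[i]).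
  move=> [r s]; rewrite ltcE/= => /andP[/eqP -> r0].
  rewrite -[r +i* 0]/(r%:C).
  have r20 : 0 < r / 2 by rewrite divr_gt0.
  have := uRe _ r20; have := uIm _ r20.
  apply: filterS2 => n hIm hRe.
  rewrite normE ltcR normcE [r]splitr.
  have -> : complex.Re (l - u n) = complex.Re l - complex.Re (u n).
    by case: l {uRe uIm hIm hRe} => a b; case: (u n).
  have -> : complex.Im (l - u n) = complex.Im l - complex.Im (u n).
    by case: l {uRe uIm hIm hRe} => a b; case: (u n).
  apply: (le_lt_trans _ (ltrD hRe hIm)).
  move: (complex.Re l - _) (complex.Im l - _) => x y.
  rewrite -[leRHS]ger0_norm ?addr_ge0// -sqrtr_sqr ler_wsqrtr//.
  rewrite sqrrD !real_normK ?num_real//.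
  by rewrite addrAC lerDl mulrn_wge0// mulr_ge0.
Qed.

Record circle (R : rcfType) := Circle {
  circle_val :> R[i];
  _ : `|circle_val| == 1 }.

HB.instance Definition _ (R : rcfType) := [isSub for @circle_val R].
HB.instance Definition _ (R : rcfType) := [Choice of circle R by <:].

Definition circle1 (R : rcfType) : circle R := Circle (introT eqP (normr1 R[i])).
HB.instance Definition _ (R : rcfType) := isPointed.Build (circle R) (circle1 R).
HB.instance Definition _ (R : rcfType) :=
  Topological.copy (circle R) (initial_topology (@circle_val R)).

HB.instance Definition _ (R : rcfType) :=
  Measurable.copy (circle R) (g_sigma_algebraType (@open (circle R))).

(* Values on non-measurable sets are unconstrained. *)
Record cmeasure d (T : measurableType d) (R : realType) := CMeasure {
  cmeasure_fun :> set T -> R[i];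
  cmeasure_sigma_additive : forall F : nat -> set T,
    (forall i, measurable (F i)) -> trivIset setT F ->
    (fun n => \sum_(0 <= i < n) cmeasure_fun (F i)) @ \oo -->
      cmeasure_fun (\bigcup_i F i) }.
Arguments cmeasure_sigma_additive {d T R} c [F].

Section complex_sums.
Variable R : realType.

Lemma Re_sum (u : nat -> R[i]) n :
  complex.Re (\sum_(0 <= i < n) u i) = \sum_(0 <= i < n) complex.Re (u i).
Proof. by apply: (big_morph (@complex.Re R)) => // -[a b] [c e]. Qed.

Lemma Im_sum (u : nat -> R[i]) n :
  complex.Im (\sum_(0 <= i < n) u i) = \sum_(0 <= i < n) complex.Im (u i).
Proof. by apply: (big_morph (@complex.Im R)) => // -[a b] [c e]. Qed.

End complex_sums.

Section charge_parts.
Context d (T : measurableType d) (R : realType) (mu : cmeasure T R).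

Let cst_sum0 (a : R) :
  (fun n => \sum_(0 <= i < n) a) @ \oo --> a -> a = 0.
Proof.
move=> ua; have ua1 := ua; rewrite -cvg_shiftS in ua1.
have : (fun n => \sum_(0 <= i < n.+1) a - \sum_(0 <= i < n) a) @ \oo --> a - a.
  exact: cvgB.
under eq_fun do rewrite big_nat_recr//= addrAC subrr add0r.
by rewrite subrr => /(cvg_lim (@Rhausdorff R)) <-; rewrite lim_cst.
Qed.

Let cvg_Re (F : nat -> set T) : (forall i, measurable (F i)) ->
  trivIset setT F ->
  (fun n => \sum_(0 <= i < n) complex.Re (mu (F i))) @ \oo -->
    complex.Re (mu (\bigcup_i F i)).
Proof.
move=> mF tF; have /cvg_complexP[+ _] := cmeasure_sigma_additive mu mF tF.
by under eq_fun do rewrite Re_sum.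
Qed.

Let cvg_Im (F : nat -> set T) : (forall i, measurable (F i)) ->
  trivIset setT F ->
  (fun n => \sum_(0 <= i < n) complex.Im (mu (F i))) @ \oo -->
    complex.Im (mu (\bigcup_i F i)).
Proof.
move=> mF tF; have /cvg_complexP[_] := cmeasure_sigma_additive mu mF tF.
by under eq_fun do rewrite Im_sum.
Qed.

Lemma cmeasure0 : mu set0 = 0.
Proof.
have m0 : forall i : nat, measurable ((fun=> set0) i : set T) by [].
have t0 : trivIset setT (fun _ : nat => set0 : set T).
  by move=> i j _ _ [x []].
have := cst_sum0 (eq_ind _ (fun S => (fun n => \sum_(0 <= i < n) complex.Re (mu set0)) @ \oo --> complex.Re (mu S)) (cvg_Re m0 t0) _ (bigcup0 (fun _ _ => erefl))).
have := cst_sum0 (eq_ind _ (fun S => (fun n => \sum_(0 <= i < n) complex.Im (mu set0)) @ \oo --> complex.Im (mu S)) (cvg_Im m0 t0) _ (bigcup0 (fun _ _ => erefl))).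
by case: (mu set0) => a b /= -> ->.
Qed.

Definition charge_re (A : set T) : \bar R := (complex.Re (mu A))%:E.
Definition charge_im (A : set T) : \bar R := (complex.Im (mu A))%:E.

Let charge_re0 : charge_re set0 = 0%E. Proof. by rewrite /charge_re cmeasure0. Qed.
Let charge_im0 : charge_im set0 = 0%E. Proof. by rewrite /charge_im cmeasure0. Qed.

Let charge_re_sigma_additive : semi_sigma_additive charge_re.
Proof.
move=> F mF tF _; under eq_fun do rewrite /charge_re sumEFin.
by apply: cvg_EFin; [exact: nearW|exact: cvg_Re].
Qed.

Let charge_im_sigma_additive : semi_sigma_additive charge_im.
Proof.
move=> F mF tF _; under eq_fun do rewrite /charge_im sumEFin.
by apply: cvg_EFin; [exact: nearW|exact: cvg_Im].
Qed.

HB.instance Definition _ :=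
  isCharge.Build _ T R charge_re charge_re0 (fun _ _ => isT) charge_re_sigma_additive.
HB.instance Definition _ :=
  isCharge.Build _ T R charge_im charge_im0 (fun _ _ => isT) charge_im_sigma_additive.

End charge_parts.

Section charge_integral.
Context d (T : measurableType d) (R : realType) (nu : {charge set T -> \bar R}).

Definition hahn_pos : set T := sval (cid (Hahn_decomposition nu)).
Definition hahn_neg : set T := sval (cid (svalP (cid (Hahn_decomposition nu)))).
Definition hahnP : hahn_decomposition nu hahn_pos hahn_neg :=
  svalP (cid (svalP (cid (Hahn_decomposition nu)))).

(* The result does not depend on the Hahn decomposition that is chosen. *)
Definition charge_integral (f : T -> R) : R :=
  \int[jordan_pos hahnP]_x f x - \int[jordan_neg hahnP]_x f x.

End charge_integral.

Definition cintegral d (T : measurableType d) (R : realType)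
    (mu : cmeasure T R) (f : T -> R[i]) : R[i] :=
  (charge_integral (charge_re mu) (fun x => complex.Re (f x)) -
   charge_integral (charge_im mu) (fun x => complex.Im (f x))) +i*
  (charge_integral (charge_im mu) (fun x => complex.Re (f x)) +
   charge_integral (charge_re mu) (fun x => complex.Im (f x))).

Section conjugate.
Context d (T : measurableType d) (R : realType) (mu : cmeasure T R).

Let conj_sigma_additive (F : nat -> set T) :
  (forall i, measurable (F i)) -> trivIset setT F ->
  (fun n => \sum_(0 <= i < n) (mu (F i))^*) @ \oo --> (mu (\bigcup_i F i))^*.
Proof.
move=> mF tF; have /cvg_complexP[cRe cIm] := cmeasure_sigma_additive mu mF tF.
have ReJ (z : R[i]) : complex.Re z^* = complex.Re z by case: z.
have ImJ (z : R[i]) : complex.Im z^* = - complex.Im z by case: z.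
apply/cvg_complexP; split.
  by rewrite ReJ; under eq_fun do [rewrite -rmorph_sum ReJ].
rewrite ImJ; under eq_fun do [rewrite -rmorph_sum ImJ].
exact: cvgN.
Qed.

Definition cmeasure_conj : cmeasure T R := @CMeasure _ _ _ (fun A => (mu A)^*) conj_sigma_additive.

End conjugate.

Section of_measure.
Context d (T : measurableType d) (R : realType).
Variable m : {finite_measure set T -> \bar R}.

Let of_measure_sigma_additive (F : nat -> set T) :
  (forall i, measurable (F i)) -> trivIset setT F ->
  (fun n => \sum_(0 <= i < n) (fine (m (F i)))%:C) @ \oo -->
    (fine (m (\bigcup_i F i)))%:C.
Proof.
move=> mF tF; apply/cvg_complexP; split => /=; last first.
  by under eq_fun do rewrite Im_sum /= big1//; exact: cvg_cst.
under eq_fun do rewrite Re_sum /=.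
have mU : measurable (\bigcup_i F i) by exact: bigcup_measurable.
have H : (fun n => (\sum_(0 <= i < n) m (F i))%E) @ \oo -->
    (fine (m (\bigcup_i F i)))%:E.
  by rewrite fineK ?fin_num_measure//; exact: measure_semi_sigma_additive.
have [_ {}H] := (fine_cvgP _ _).1 H.
rewrite (_ : (fun n => _) =
  fine \o (fun n => (\sum_(0 <= i < n) m (F i))%E))//.
by apply/funext => n /=; rewrite sum_fine// => i _; exact: fin_num_measure.
Qed.

Definition cmeasure_of_measure : cmeasure T R :=
  @CMeasure _ _ _ (fun A => (fine (m A))%:C) of_measure_sigma_additive.

End of_measure.

Section charge_integral_theory.
Context d (T : measurableType d) (R : realType).

Definition bounded_measurable (f : T -> R) :=
  measurable_fun setT f /\ exists M, forall x, `|f x| <= M.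

Lemma bounded_measurable_integrable (m : {finite_measure set T -> \bar R}) f :
  bounded_measurable f -> m.-integrable setT (EFin \o f).
Proof.
move=> [mf [M fM]]; apply: measurable_bounded_integrable => //.
  by rewrite -ge0_fin_numE// fin_num_measure.
exists M; split; first exact: num_real.
by move=> x Mx y _ /=; rewrite (le_trans (fM y))// ltW.
Qed.

Variable nu : {charge set T -> \bar R}.

Lemma charge_integral0 : charge_integral nu (fun=> 0) = 0.
Proof. by rewrite /charge_integral /Rintegral !integral0 subrr. Qed.

Lemma charge_integralD f g : bounded_measurable f -> bounded_measurable g ->
  charge_integral nu (fun x => f x + g x) =
  charge_integral nu f + charge_integral nu g.
Proof.
move=> mf mg; rewrite /charge_integral !RintegralD//;
  try exact: bounded_measurable_integrable.
by rewrite opprD addrACA.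
Qed.

Lemma bounded_measurable_sum (f : nat -> T -> R) n :
  (forall i, bounded_measurable (f i)) ->
  bounded_measurable (fun x => \sum_(0 <= i < n) f i x).
Proof.
move=> bf; split; first by apply: measurable_sum => i; case: (bf i).
have /choice[M fM] : forall i, exists M, forall x, `|f i x| <= M.
  by move=> i; case: (bf i).
exists (\sum_(0 <= i < n) M i) => x.
by rewrite (le_trans (ler_norm_sum _ _ _))// ler_sum.
Qed.

Lemma charge_integral_sum (f : nat -> T -> R) n :
  (forall i, bounded_measurable (f i)) ->
  charge_integral nu (fun x => \sum_(0 <= i < n) f i x) =
  \sum_(0 <= i < n) charge_integral nu (f i).
Proof.
move=> bf; elim: n => [|n IHn].
  rewrite big_nil -[RHS]charge_integral0; congr charge_integral.
  by apply/funext => x; rewrite big_nil.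
rewrite big_nat_recr//= -IHn -charge_integralD//; last exact: bounded_measurable_sum.
by congr charge_integral; apply/funext => x; rewrite big_nat_recr.
Qed.

Let Rintegral_cvg (m : {finite_measure set T -> \bar R})
    (f_ : nat -> T -> R) (f : T -> R) M :
  (forall n, measurable_fun setT (f_ n)) ->
  (forall n x, `|f_ n x| <= M) ->
  (forall x, f_ n x @[n --> \oo] --> f x) ->
  \int[m]_x f_ n x @[n --> \oo] --> \int[m]_x f x.
Proof.
move=> mf_ bf_ f_f.
have mf : measurable_fun setT f.
  by apply: (measurable_fun_cvg mf_) => x _; exact: f_f.
have [] := @dominated_convergence _ _ _ m setT measurableT
  (fun n x => (f_ n x)%:E) (EFin \o f) (cst M%:E).
- by move=> n; exact/measurable_EFinP.
- exact/measurable_EFinP.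
- by apply: aeW => x _; apply: cvg_EFin; [exact: nearW|exact: f_f].
- exact: finite_measure_integrable_cst.
- by apply: aeW => x n _; rewrite lee_fin.
move=> intf _ H; rewrite /Rintegral; apply: fine_cvg.
by rewrite fineK//; exact: integrable_fin_num.
Qed.

Lemma charge_integral_cvg (f_ : nat -> T -> R) (f : T -> R) M :
  (forall n, measurable_fun setT (f_ n)) ->
  (forall n x, `|f_ n x| <= M) ->
  (forall x, f_ n x @[n --> \oo] --> f x) ->
  charge_integral nu (f_ n) @[n --> \oo] --> charge_integral nu f.
Proof. by move=> mf bf cf; apply: cvgB; exact: Rintegral_cvg cf. Qed.

Lemma charge_jordanE A : measurable A ->
  fine (nu A) = fine (jordan_pos (hahnP nu) A) - fine (jordan_neg (hahnP nu) A).
Proof.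
move=> mA; rewrite (jordan_decomp (hahnP nu) mA) /cadd/= cscaleN1.
by rewrite fineB// fin_num_measure.
Qed.

Lemma charge_bounded : exists M, forall A, measurable A -> `|fine (nu A)| <= M.
Proof.
exists (fine (jordan_pos (hahnP nu) setT) + fine (jordan_neg (hahnP nu) setT)).
move=> A mA; rewrite charge_jordanE// (le_trans (ler_normB _ _))//.
rewrite !ger0_norm ?fine_ge0//.
by rewrite lerD// fine_le ?fin_num_measure// le_measure// inE.
Qed.

Lemma charge_integral_indic A : measurable A ->
  charge_integral nu \1_A = fine (nu A).
Proof.
move=> mA; rewrite charge_jordanE// /charge_integral /Rintegral.
by rewrite !integral_indic// setIT.
Qed.

Lemma charge_integralZr f r : bounded_measurable f ->
  charge_integral nu (fun x => f x * r) = charge_integral nu f * r.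
Proof.
move=> bf; rewrite /charge_integral !RintegralZr//;
  try exact: bounded_measurable_integrable.
by rewrite mulrBl.
Qed.

End charge_integral_theory.

Section product.
Context d1 d2 (T1 : measurableType d1) (T2 : measurableType d2) (R : realType).

Lemma bounded_measurable_charge_xsection (nu : {charge set T2 -> \bar R})
    (A : set (T1 * T2)) : measurable A ->
  bounded_measurable (fun x => fine (nu (xsection A x))).
Proof.
move=> mA; split; last first.
  have [M nuM] := charge_bounded nu.
  by exists M => x; apply: nuM; exact: measurable_xsection.
rewrite (_ : (fun x => _) = (fun x =>
   fine (jordan_pos (hahnP nu) (xsection A x)) -
   fine (jordan_neg (hahnP nu) (xsection A x)))); last first.
  by apply/funext => x; apply: charge_jordanE; exact: measurable_xsection.
apply: measurable_funB; apply: (measurableT_comp (@fine_measurable R setT _)) => //.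
- exact: (measurable_fun_xsection (jordan_pos (hahnP nu)) mA).
- exact: (measurable_fun_xsection (jordan_neg (hahnP nu)) mA).
Qed.

Variables (mu : cmeasure T1 R) (nu : cmeasure T2 R).

Let charge_integral_xsection_cvg (m : {charge set T1 -> \bar R})
  (n : {charge set T2 -> \bar R}) (F : nat -> set (T1 * T2)) :
  (forall i, measurable (F i)) -> trivIset setT F ->
  (fun k => \sum_(0 <= i < k)
    charge_integral m (fun x => fine (n (xsection (F i) x)))) @ \oo -->
  charge_integral m (fun x => fine (n (xsection (\bigcup_i F i) x))).
Proof.
move=> mF tF; have bF i := bounded_measurable_charge_xsection n (mF i).
under eq_fun do rewrite -charge_integral_sum//.
have [M nM] := charge_bounded n.
have sumE k x : \sum_(0 <= i < k) fine (n (xsection (F i) x)) =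
    fine (n (xsection (\bigcup_(i < k) F i) x)).
  have -> : xsection (\bigcup_(i < k) F i) x =
      \big[setU/set0]_(i < k) xsection (F i) x.
    rewrite -(bigcup_mkord k (fun i => xsection (F i) x)) /xsection.
    apply/seteqP; split => y /=; first rewrite inE.
      by move=> [i ik Fi]; exists i => //=; rewrite inE.
    by move=> [i ik] /=; rewrite !inE => Fi; exists i.
  rewrite (@charge_semi_additive _ _ _ n (fun i => xsection (F i) x) k)//.
  - by rewrite big_mkord sum_fine// => i _; apply: fin_num_measure; exact: measurable_xsection.
  - by move=> i; exact: measurable_xsection.
  - exact: trivIset_xsection.
  - by apply: bigsetU_measurable => i _; exact: measurable_xsection.
apply: (@charge_integral_cvg _ _ _ m _ _ M).
- by move=> k; case: (bounded_measurable_sum k bF).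
- move=> k x; rewrite sumE; apply: nM; apply: measurable_xsection.
  exact: bigcup_measurable.
- move=> x.
  have mFx i : measurable (xsection (F i) x) by exact: measurable_xsection.
  have mU : measurable (\bigcup_i xsection (F i) x) by exact: bigcup_measurable.
  have H : (fun k => (\sum_(0 <= i < k) n (xsection (F i) x))%E) @ \oo -->
      (fine (n (xsection (\bigcup_i F i) x)))%:E.
    rewrite xsection_bigcup fineK ?fin_num_measure//.
    by apply: charge_semi_sigma_additive => //; exact: trivIset_xsection.
  have [_ {}H] := (fine_cvgP _ _).1 H.
  rewrite (_ : (fun k => _) =
    fine \o (fun k => (\sum_(0 <= i < k) n (xsection (F i) x))%E))//.
  apply/funext => k /=; rewrite sum_fine// => i _.
  by rewrite fin_num_measure.
Qed.

(* Same shape as the library's product of measures; cmeasure_prodX below gives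
   the values on measurable rectangles. *)
Definition cmeasure_prod_fun (A : set (T1 * T2)) : R[i] :=
  cintegral mu (fun x => nu (xsection A x)).

Let prod_sigma_additive (F : nat -> set (T1 * T2)) :
  (forall i, measurable (F i)) -> trivIset setT F ->
  (fun n => \sum_(0 <= i < n) cmeasure_prod_fun (F i)) @ \oo -->
    cmeasure_prod_fun (\bigcup_i F i).
Proof.
move=> mF tF; apply/cvg_complexP; split => /=.
- under eq_fun do rewrite Re_sum /= sumrB.
  by apply: cvgB;
    [exact: (@charge_integral_xsection_cvg (charge_re mu) (charge_re nu))|
     exact: (@charge_integral_xsection_cvg (charge_im mu) (charge_im nu))].
- under eq_fun do rewrite Im_sum /= big_split/=.
  by apply: cvgD;
    [exact: (@charge_integral_xsection_cvg (charge_im mu) (charge_re nu))|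
     exact: (@charge_integral_xsection_cvg (charge_re mu) (charge_im nu))].
Qed.

Definition cmeasure_prod : cmeasure (T1 * T2)%type R :=
  CMeasure prod_sigma_additive.

Lemma cmeasure_prodX A B : measurable A -> measurable B ->
  cmeasure_prod (A `*` B) = mu A * nu B.
Proof.
move=> mA mB.
have bA : bounded_measurable (\1_A : T1 -> R).
  split; first exact: measurable_indic.
  by exists 1 => x; rewrite indicE; case: (x \in A); rewrite ?normr1 ?normr0.
have xE x : nu (xsection (A `*` B) x) =
    ((\1_A x * complex.Re (nu B)) +i* (\1_A x * complex.Im (nu B))).
  rewrite indicE; have [xA|xA] := boolP (x \in A).
    by rewrite in_xsectionX// !mul1r; case: (nu B).
  by rewrite notin_xsectionX// cmeasure0 !mul0r.
rewrite /= /cmeasure_prod_fun /cintegral.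
under [fun x => complex.Re _]eq_fun do rewrite xE /=.
under [fun x => complex.Im _]eq_fun do rewrite xE /=.
rewrite !charge_integralZr// !charge_integral_indic//=.
by case: (mu A) (nu B) => [a b] [c e] /=; congr Complex; rewrite addrC.
Qed.

End product.

Definition fourier (R : realType) (mu : cmeasure (circle R) R) (k : nat) : R[i] :=
  cintegral mu (fun z => (z : R[i]) ^+ k).

(* Sequences are indexed by {1, 2, ...}; the value at index 0 is never used. *)
Definition cesaro (K : fieldType) (u : nat -> K) (N : nat) : K :=
  N%:R^-1 * \sum_(1 <= n < N.+1) u n.

Definition subsequence (k : nat -> nat) : Prop :=
  (forall n, (0 < n)%N -> (0 < k n)%N) /\
  exists n0, forall m n, (n0 <= m)%N -> (m < n)%N -> (k m < k n)%N.

Definition good (R : realType) (k : nat -> nat) : Prop :=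
  subsequence k /\
  forall l : circle R, cvg (cesaro (fun n => (l : R[i]) ^+ k n) @ \oo).

Definition limit_function (R : realType) (k : nat -> nat) (l : R[i]) : R[i] :=
  lim (cesaro (fun n => l ^+ k n) @ \oo).

Definition ergodic (R : realType) (k : nat -> nat) : Prop :=
  good R k /\
  forall l : circle R, limit_function k l = ((l : R[i]) == 1)%:R.

Definition wiener_mean (R : realType) (k : nat -> nat)
    (mu : cmeasure (circle R) R) : nat -> R :=
  cesaro (fun n => Normc.normc (fourier mu (k n)) ^+ 2).

Definition atoms (R : realType) (mu : cmeasure (circle R) R) : set (circle R) :=
  [set a | mu [set a] != 0].

(* Main.v *)
Require Import Defs.
From HB Require Import structures.
From mathcomp Require Import all_boot all_order all_algebra.
From mathcomp Require Import all_classical all_reals all_analysis.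
From mathcomp Require Import measurable_realfun complex ring.

Set Implicit Arguments.
Unset Strict Implicit.
Unset Printing Implicit Defensive.

Import Order.TTheory GRing.Theory Num.Theory.
Import numFieldNormedType.Exports.

Local Open Scope classical_set_scope.
Local Open Scope ring_scope.
Local Open Scope complex_scope.

(** Everything rests on one identity: by Fubini,
    |mu^(n)|^2 = int (z1 conj(z2))^n d(mu x conj mu), so (a) is bounded
    convergence for Cesaro means.  If the sequence is ergodic, the limit function
    at z1 conj(z2) is the indicator of the diagonal, whose (mu x conj mu)-measure
    is int conj(mu{x}) dmu(x), i.e. the sum of |mu{a}|^2 over the countably many
    atoms.  Conversely, mu = delta_1 + t delta_l with |t| = 1 has
    |mu^(n)|^2 = 2 + 2 Re (t l^n), so (b) for t = 1 and t = -i kills the real and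
    the imaginary part of the limit function at l <> 1.  For (c), the weights p of
    a probability have sum p <= 1, so sum p^2 = 1 forces p = p^2 at every atom. *)

Import HBNNSimple.

(** * Bounded measurable functions *)

Section bounded_measurable_theory.
Context d (T : measurableType d) (R : realType).
Implicit Types f g : T -> R.

Lemma bounded_measurable_cst (a : R) : bounded_measurable (fun _ : T => a).
Proof. by split; [exact: measurable_cst|exists `|a|]. Qed.

Lemma bounded_measurable_indic (A : set T) : measurable A ->
  bounded_measurable (\1_A : T -> R).
Proof.
move=> mA; split; first exact: measurable_indic.
by exists 1 => x; rewrite indicE; case: (x \in A); rewrite ?normr1 ?normr0.
Qed.

Lemma bounded_measurableD f g : bounded_measurable f -> bounded_measurable g ->
  bounded_measurable (fun x => f x + g x).
Proof.
move=> [mf [M fM]] [mg [N gN]]; split; first exact: measurable_funD.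
by exists (M + N) => x; rewrite (le_trans (ler_normD _ _))// lerD.
Qed.

Lemma bounded_measurableM f g : bounded_measurable f -> bounded_measurable g ->
  bounded_measurable (fun x => f x * g x).
Proof.
move=> [mf [M fM]] [mg [N gN]]; split; first exact: measurable_funM.
by exists (M * N) => x; rewrite normrM ler_pM.
Qed.

Lemma bounded_measurableN f : bounded_measurable f ->
  bounded_measurable (fun x => - f x).
Proof.
move=> [mf [M fM]]; split; first by apply: measurable_funN.
by exists M => x; rewrite normrN.
Qed.

(** Simple functions are finite combinations of indicators, a nonnegative bounded function is an
    increasing limit of simple ones, and [f] is its positive part minus its negative part.
    Identities between integrals then only have to be checked on indicators. *)
Lemma bounded_measurable_ind (P : (T -> R) -> Prop) :
  (forall A, measurable A -> P \1_A) ->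
  (forall f g, bounded_measurable f -> bounded_measurable g ->
    P f -> P g -> P (fun x => f x + g x)) ->
  (forall a f, bounded_measurable f -> P f -> P (fun x => a * f x)) ->
  (forall (f_ : nat -> T -> R) f (M : R),
    (forall n, bounded_measurable (f_ n)) -> (forall n x, `|f_ n x| <= M) ->
    (forall x, f_ n x @[n --> \oo] --> f x) -> (forall n, P (f_ n)) -> P f) ->
  forall f, bounded_measurable f -> P f.
Proof.
move=> P1 PD PZ Plim.
(* The closure hypotheses on [P] ask for bounded measurable arguments, so both properties are
   carried through the induction on simple functions. *)
pose Q f := bounded_measurable f /\ P f.
have Qsfun (h : {nnsfun T >-> R}) : Q h.
  rewrite (_ : h = (fun x => \sum_(y \in range h) y * \1_(h @^-1` [set y]) x) :> (T -> R));
    last by apply/funext => x; rewrite -fimfunE.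
  under eq_fun do rewrite fsbig_finite//.
  elim: (finmap.enum_fset _) => [|y s [bs Ps]].
    (* The empty sum is reached as 0 times the indicator of the empty set. *)
    under eq_fun do rewrite big_nil; split; first exact: bounded_measurable_cst.
    have := PZ 0 _ (bounded_measurable_indic measurable0) (P1 _ measurable0).
    by under eq_fun do rewrite mul0r.
  under eq_fun do rewrite big_cons.
  have mA : measurable (h @^-1` [set y]).
    by rewrite -[X in measurable X]setTI; exact: measurable_funP.
  have bA := bounded_measurable_indic mA.
  have bM : bounded_measurable (fun x => y * \1_(h @^-1` [set y]) x).
    by apply: bounded_measurableM => //; exact: bounded_measurable_cst.
  split; first exact: bounded_measurableD.
  by apply: PD => //; apply: PZ => //; exact: P1.
have Pge0 f : bounded_measurable f -> (forall x, 0 <= f x) -> P f.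
  move=> [mf [M fM]] f0.
  have /measurable_EFinP mf' := mf.
  pose h n := nnsfun_approx measurableT mf' n.
  have hf x : h n x @[n --> \oo] --> f x.
    have H : EFin \o (h ^~ x) @ \oo --> (f x)%:E.
      by apply: (cvg_nnsfun_approx measurableT mf') => // y _; rewrite lee_fin.
    by have [] := (fine_cvgP _ _).1 H.
  apply: (Plim h _ M) => //.
  - by move=> n; have [] := Qsfun (h n).
  (* The approximants increase to [f], so each lies below [f], hence below [M]: this is the uniform
     bound that [Plim] requires. *)
  - move=> n x; have hn0 : 0 <= h n x by exact: fun_ge0.
    rewrite ger0_norm// (le_trans _ (fM x))// (le_trans _ (ler_norm _))//.
    rewrite -(cvg_lim _ (hf x))//; apply: nondecreasing_cvgn_le.
      by move=> a b ab; exact/lefP/nd_nnsfun_approx.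
    by apply/cvg_ex; exists (f x).
  - by move=> n; have [] := Qsfun (h n).
move=> f [mf [M fM]].
have bM f' : measurable_fun setT f' -> (forall x, 0 <= f' x) ->
    (forall x, f' x <= `|f x|) -> bounded_measurable f'.
  move=> mf' f'0 f'f; split => //; exists M => x.
  by rewrite ger0_norm// (le_trans _ (fM x)).
have bp : bounded_measurable f^\+.
  apply: bM => [|x|x]; first exact: measurable_funrpos.
    exact: funrpos_ge0.
  by rewrite /funrpos ge_max normr_ge0 ler_norm.
have bn : bounded_measurable f^\-.
  apply: bM => [|x|x]; first exact: measurable_funrneg.
    exact: funrneg_ge0.
  by rewrite /funrneg ge_max normr_ge0 -normrN ler_norm.
have -> : f = (fun x => f^\+ x + (-1) * f^\- x).
  by apply/funext => x; rewrite mulN1r -{1}(funrposBneg f).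
apply: PD => //.
- by apply: bounded_measurableM => //; exact: bounded_measurable_cst.
- by apply: Pge0 => // x; exact: funrpos_ge0.
- by apply: PZ => //; apply: Pge0 => // x; exact: funrneg_ge0.
Qed.

End bounded_measurable_theory.

(** * Modulus, real and imaginary parts *)

Section complex_modulus.
Variable R : rcfType.
Implicit Types z : R[i].

Lemma normc_ReIm z : Normc.normc z = Num.sqrt (complex.Re z ^+ 2 + complex.Im z ^+ 2).
Proof. by case: z. Qed.

Lemma normc_ge0 z : 0 <= Normc.normc z.
Proof. by rewrite normc_ReIm sqrtr_ge0. Qed.

Lemma normc_sqr_ReIm z : Normc.normc z ^+ 2 = complex.Re z ^+ 2 + complex.Im z ^+ 2.
Proof. by rewrite normc_ReIm sqr_sqrtr// addr_ge0// sqr_ge0. Qed.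

Lemma ler_Re_normc z : `|complex.Re z| <= Normc.normc z.
Proof. by rewrite normc_ReIm -sqrtr_sqr ler_wsqrtr// lerDl sqr_ge0. Qed.

Lemma ler_Im_normc z : `|complex.Im z| <= Normc.normc z.
Proof. by rewrite normc_ReIm -sqrtr_sqr ler_wsqrtr// lerDr sqr_ge0. Qed.

Lemma normc_leD z w : Normc.normc (z + w) <= Normc.normc z + Normc.normc w.
Proof. by rewrite -lecR rmorphD; exact: (ler_normD z w). Qed.

Lemma normc_le_ReIm z : Normc.normc z <= `|complex.Re z| + `|complex.Im z|.
Proof.
rewrite normc_ReIm -[leRHS]ger0_norm ?addr_ge0// -[leRHS]sqrtr_sqr ler_wsqrtr//.
rewrite sqrrD !real_normK ?num_real//.
by rewrite addrAC lerDl mulrn_wge0// mulr_ge0.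
Qed.

Lemma normc_sqr z : (Normc.normc z ^+ 2)%:C = z * z^*.
Proof.
rewrite normc_sqr_ReIm; case: z => a b; apply/eqP; rewrite eq_complex /=.
by rewrite mulrN opprK -!expr2 eqxx /= mulrN mulrC addNr eqxx.
Qed.

Lemma normc_conj z : Normc.normc z^* = Normc.normc z.
Proof. by rewrite !normc_ReIm; case: z => a b /=; rewrite sqrrN. Qed.

Lemma Re_add z w : complex.Re (z + w) = complex.Re z + complex.Re w.
Proof. by case: z w => [a b] []. Qed.

Lemma Im_add z w : complex.Im (z + w) = complex.Im z + complex.Im w.
Proof. by case: z w => [a b] []. Qed.

Lemma Re_mul z w : complex.Re (z * w) =
  complex.Re z * complex.Re w - complex.Im z * complex.Im w.
Proof. by case: z w => [a b] []. Qed.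

Lemma Im_mul z w : complex.Im (z * w) =
  complex.Re z * complex.Im w + complex.Im z * complex.Re w.
Proof. by case: z w => [a b] []. Qed.

Lemma Re_conjc z : complex.Re z^* = complex.Re z.
Proof. by case: z. Qed.

Lemma Im_conjc z : complex.Im z^* = - complex.Im z.
Proof. by case: z. Qed.

Lemma normc_sqr_add1 z : Normc.normc z = 1 ->
  Normc.normc (1 + z) ^+ 2 = 2 + 2 * complex.Re z.
Proof.
move=> z1; have : Normc.normc z ^+ 2 = 1 by rewrite z1 expr1n.
rewrite !normc_sqr_ReIm; case: z {z1} => a b /= ab.
transitivity (1 + 2 * a + (a ^+ 2 + b ^+ 2)); first by ring.
by rewrite ab; ring.
Qed.

End complex_modulus.

(** * Bounded measurable complex functions *)

Definition cbounded_measurable d (T : measurableType d) (R : realType)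
    (f : T -> R[i]) :=
  bounded_measurable (fun x => complex.Re (f x)) /\
  bounded_measurable (fun x => complex.Im (f x)).

Section cbounded_measurable_theory.
Context d (T : measurableType d) (R : realType).
Implicit Types (f g : T -> R[i]) (A : set T).

Lemma cbounded_measurable_bound f : cbounded_measurable f ->
  exists M, forall x, Normc.normc (f x) <= M.
Proof.
move=> [[_ [M fM]] [_ [N fN]]]; exists (M + N) => x.
by rewrite (le_trans (normc_le_ReIm _))// lerD.
Qed.

Lemma cbounded_measurable_real (f : T -> R) : bounded_measurable f ->
  cbounded_measurable (fun x => (f x)%:C).
Proof. by split=> //; exact: bounded_measurable_cst. Qed.

Lemma cbounded_measurable_cst (a : R[i]) : cbounded_measurable (fun _ : T => a).
Proof. by split; exact: bounded_measurable_cst. Qed.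

Lemma cbounded_measurable_indic A : measurable A ->
  cbounded_measurable (fun x => (\1_A x)%:C : R[i]).
Proof.
by move=> mA; apply: cbounded_measurable_real; exact: bounded_measurable_indic.
Qed.

Lemma cbounded_measurableD f g :
  cbounded_measurable f -> cbounded_measurable g ->
  cbounded_measurable (fun x => f x + g x).
Proof.
move=> [fR fI] [gR gI]; split.
  by under eq_fun do rewrite Re_add; exact: bounded_measurableD.
by under eq_fun do rewrite Im_add; exact: bounded_measurableD.
Qed.

Lemma cbounded_measurableM f g :
  cbounded_measurable f -> cbounded_measurable g ->
  cbounded_measurable (fun x => f x * g x).
Proof.
move=> [fR fI] [gR gI]; split.
  under eq_fun do rewrite Re_mul; apply: bounded_measurableD.
    exact: bounded_measurableM.
  by apply: bounded_measurableN; exact: bounded_measurableM.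
by under eq_fun do rewrite Im_mul; apply: bounded_measurableD;
  exact: bounded_measurableM.
Qed.

Lemma cbounded_measurableX f n : cbounded_measurable f ->
  cbounded_measurable (fun x => f x ^+ n).
Proof.
move=> bf; elim: n => [|n IHn].
  by under eq_fun do rewrite expr0; exact: cbounded_measurable_cst.
by under eq_fun do rewrite exprS; exact: cbounded_measurableM.
Qed.

Lemma cbounded_measurable_conj f : cbounded_measurable f ->
  cbounded_measurable (fun x => (f x)^*).
Proof.
move=> [fR fI]; split; first by under eq_fun do rewrite Re_conjc.
by under eq_fun do rewrite Im_conjc; exact: bounded_measurableN.
Qed.

Lemma cbounded_measurable_sum (f : nat -> T -> R[i]) m n :
  (forall i, cbounded_measurable (f i)) ->
  cbounded_measurable (fun x => \sum_(m <= i < n) f i x).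
Proof.
move=> bf; rewrite /index_iota; elim: (iota m (n - m)) => [|i s IHs].
  by under eq_fun do rewrite big_nil; exact: cbounded_measurable_cst.
by under eq_fun do rewrite big_cons; exact: cbounded_measurableD.
Qed.

(** The real induction principle, applied to the property of [h] that [P] holds of [h] seen as a
    complex function, settles real functions; then [f] is [Re f + i Im f]. *)
Lemma cbounded_measurable_ind (P : (T -> R[i]) -> Prop) :
  (forall A, measurable A -> P (fun x => (\1_A x)%:C)) ->
  (forall f g, cbounded_measurable f -> cbounded_measurable g ->
    P f -> P g -> P (fun x => f x + g x)) ->
  (forall a f, cbounded_measurable f -> P f -> P (fun x => a * f x)) ->
  (forall (f_ : nat -> T -> R[i]) f (M : R),
    (forall n, cbounded_measurable (f_ n)) ->
    (forall n x, Normc.normc (f_ n x) <= M) ->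
    (forall x, f_ n x @[n --> \oo] --> f x) -> (forall n, P (f_ n)) -> P f) ->
  forall f, cbounded_measurable f -> P f.
Proof.
move=> P1 PD PZ Plim f [fR fI].
have Preal (h : T -> R) : bounded_measurable h -> P (fun x => (h x)%:C).
  move=> bh; apply: (@bounded_measurable_ind _ _ _ (fun h => P (fun x => (h x)%:C))) => //.
  - move=> f1 g bf1 bg Pf Pg.
    by under eq_fun do rewrite rmorphD/=; apply: PD => //; exact: cbounded_measurable_real.
  - move=> a f1 bf1 Pf.
    by under eq_fun do rewrite rmorphM/=; apply: PZ => //; exact: cbounded_measurable_real.
  - move=> f_ f1 M bf_ f_M f_f Pf_; apply: (Plim _ _ M _ _ _ Pf_).
    + by move=> n; exact: cbounded_measurable_real.
    + by move=> n x; rewrite normc_ReIm /= expr0n addr0 sqrtr_sqr.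
    + by move=> x; apply/cvg_complexP; split; [exact: f_f|exact: cvg_cst].
have -> : f = (fun x => (complex.Re (f x))%:C + 'i * (complex.Im (f x))%:C).
  by apply/funext => x; rewrite -complexE.
have bi : cbounded_measurable (fun x => (complex.Im (f x))%:C).
  exact: cbounded_measurable_real.
apply: PD.
- exact: cbounded_measurable_real.
- by apply: cbounded_measurableM => //; exact: cbounded_measurable_cst.
- exact: Preal.
- by apply: PZ => //; exact: Preal.
Qed.

End cbounded_measurable_theory.

(** * Integration against a complex measure *)

Section cintegral_theory.
Context d (T : measurableType d) (R : realType) (mu : cmeasure T R).
Implicit Types f g : T -> R[i].

Lemma cintegralD f g : cbounded_measurable f -> cbounded_measurable g ->
  cintegral mu (fun x => f x + g x) = cintegral mu f + cintegral mu g.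
Proof.
move=> [fR fI] [gR gI]; rewrite /cintegral.
under [fun x => complex.Re _]eq_fun do rewrite Re_add.
under [fun x => complex.Im _]eq_fun do rewrite Im_add.
rewrite !charge_integralD//; apply/eqP; rewrite eq_complex /=.
by apply/andP; split; apply/eqP; ring.
Qed.

Lemma cintegralZ a f : cbounded_measurable f ->
  cintegral mu (fun x => a * f x) = a * cintegral mu f.
Proof.
move=> [fR fI]; rewrite /cintegral; case: a => a b.
have ZE (nu : {charge set T -> \bar R}) (h : T -> R) (c : R) : bounded_measurable h ->
    charge_integral nu (fun x => c * h x) = c * charge_integral nu h.
  by move=> bh; under eq_fun do rewrite mulrC; rewrite charge_integralZr// mulrC.
have bM (h : T -> R) (c : R) : bounded_measurable h -> bounded_measurable (fun x => c * h x).
  by move=> bh; apply: bounded_measurableM => //; exact: bounded_measurable_cst.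
(* The minus sign is moved into the scalar, so that both coordinates become sums of real
   multiples. *)
under [fun x => complex.Re _]eq_fun do rewrite Re_mul /= -mulNr.
under [fun x => complex.Im _]eq_fun do rewrite Im_mul /=.
rewrite !charge_integralD//; try exact: bM.
rewrite !(ZE _ (fun x => complex.Re (f x)))// !(ZE _ (fun x => complex.Im (f x)))//.
apply/eqP; rewrite eq_complex /=.
by apply/andP; split; apply/eqP; ring.
Qed.

Lemma cintegral_indic A : measurable A ->
  cintegral mu (fun x => (\1_A x)%:C) = mu A.
Proof.
move=> mA; rewrite /cintegral /= !charge_integral_indic// !charge_integral0.
by rewrite subr0 addr0 /=; case: (mu A).
Qed.

(** Bounded convergence holds for each of the four real integrals that make up [cintegral], since
    the modulus dominates both coordinates. *)
Lemma cintegral_cvg (f_ : nat -> T -> R[i]) f (M : R) :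
  (forall n, cbounded_measurable (f_ n)) ->
  (forall n x, Normc.normc (f_ n x) <= M) ->
  (forall x, f_ n x @[n --> \oo] --> f x) ->
  cintegral mu (f_ n) @[n --> \oo] --> cintegral mu f.
Proof.
move=> bf fM f_f.
have cR (nu : {charge set T -> \bar R}) :
    charge_integral nu (fun x => complex.Re (f_ n x)) @[n --> \oo] -->
    charge_integral nu (fun x => complex.Re (f x)).
  apply: (@charge_integral_cvg _ _ _ nu _ _ M) => [n|n x|x].
  - by case: (bf n) => -[].
  - exact: le_trans (ler_Re_normc _) (fM _ _).
  - by have /cvg_complexP[] := f_f x.
have cI (nu : {charge set T -> \bar R}) :
    charge_integral nu (fun x => complex.Im (f_ n x)) @[n --> \oo] -->
    charge_integral nu (fun x => complex.Im (f x)).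
  apply: (@charge_integral_cvg _ _ _ nu _ _ M) => [n|n x|x].
  - by case: (bf n) => _ [].
  - exact: le_trans (ler_Im_normc _) (fM _ _).
  - by have /cvg_complexP[] := f_f x.
by apply/cvg_complexP; split; [exact: cvgB|exact: cvgD].
Qed.

Lemma cintegral0 : cintegral mu (fun=> 0) = 0.
Proof.
have := cintegralZ 0 (cbounded_measurable_cst T (1 : R[i])).
by under eq_fun do rewrite mul0r; rewrite mul0r.
Qed.

Lemma cintegral_sum (f : nat -> T -> R[i]) m n :
  (forall i, cbounded_measurable (f i)) ->
  cintegral mu (fun x => \sum_(m <= i < n) f i x) =
  \sum_(m <= i < n) cintegral mu (f i).
Proof.
move=> bf; rewrite /index_iota; elim: (iota m (n - m)) => [|i s IHs].
  by under eq_fun do rewrite big_nil; rewrite cintegral0 big_nil.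
under eq_fun do rewrite big_cons.
rewrite cintegralD// ?IHs ?big_cons//.
elim: s {IHs} => [|j s IHs].
  by under eq_fun do rewrite big_nil; exact: cbounded_measurable_cst.
by under eq_fun do rewrite big_cons; exact: cbounded_measurableD.
Qed.

End cintegral_theory.
Arguments cintegral_cvg {d T R} mu [f_ f M].

(** * Limits of complex sequences, coordinate by coordinate *)

Section complex_limits.
Variable R : realType.
Implicit Types (u v : nat -> R[i]) (a b : R[i]).

Lemma cvgC_unique u a b : u @ \oo --> a -> u @ \oo --> b -> a = b.
Proof.
move=> /cvg_complexP[uR uI] /cvg_complexP[vR vI].
apply/eqP; rewrite eq_complex; apply/andP; split; apply/eqP.
  exact: cvg_unique uR vR.
exact: cvg_unique uI vI.
Qed.

Lemma cvgC_D u v a b : u @ \oo --> a -> v @ \oo --> b ->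
  u n + v n @[n --> \oo] --> a + b.
Proof.
move=> /cvg_complexP[uR uI] /cvg_complexP[vR vI]; apply/cvg_complexP; split.
  by under eq_fun do rewrite Re_add; rewrite Re_add; exact: cvgD.
by under eq_fun do rewrite Im_add; rewrite Im_add; exact: cvgD.
Qed.

Lemma cvgC_M u v a b : u @ \oo --> a -> v @ \oo --> b ->
  u n * v n @[n --> \oo] --> a * b.
Proof.
move=> /cvg_complexP[uR uI] /cvg_complexP[vR vI]; apply/cvg_complexP; split.
  by under eq_fun do rewrite Re_mul; rewrite Re_mul; apply: cvgB; exact: cvgM.
by under eq_fun do rewrite Im_mul; rewrite Im_mul; apply: cvgD; exact: cvgM.
Qed.

Lemma cvgC_Ml u a b : u @ \oo --> a -> b * u n @[n --> \oo] --> b * a.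
Proof. by move=> ua; exact: (cvgC_M (u := fun=> b) (cvg_cst b) ua). Qed.

Lemma cvgC_conj u a : u @ \oo --> a -> (u n)^* @[n --> \oo] --> a^*.
Proof.
move=> /cvg_complexP[uR uI]; apply/cvg_complexP; split.
  by under eq_fun do rewrite Re_conjc; rewrite Re_conjc.
by under eq_fun do rewrite Im_conjc; rewrite Im_conjc; exact: cvgN.
Qed.

End complex_limits.
Arguments cvgC_Ml {R} [u a] b.

(** * Integrals against conjugate and two-point measures *)

Section cintegral_examples.
Context d (T : measurableType d) (R : realType).
Implicit Types (mu : cmeasure T R) (f : T -> R[i]).

(** On indicators this is the definition of the conjugate measure. In the limit step both sides are
    limits of one sequence, by bounded convergence. *)
Lemma cintegral_conj mu f : cbounded_measurable f ->
  cintegral (cmeasure_conj mu) (fun x => (f x)^*) = (cintegral mu f)^*.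
Proof.
have conjD (z w : R[i]) : (z + w)^* = z^* + w^* by exact: rmorphD.
have conjM (z w : R[i]) : (z * w)^* = z^* * w^* by exact: rmorphM.
move: f; apply: cbounded_measurable_ind.
- move=> A mA; have conjr (x : R) : (x%:C)^* = x%:C by apply/eqP; rewrite eq_complex /= oppr0 !eqxx.
  by under eq_fun do rewrite conjr; rewrite !cintegral_indic.
- move=> f g bf bg Hf Hg; under eq_fun do rewrite conjD.
  have bcf := cbounded_measurable_conj bf; have bcg := cbounded_measurable_conj bg.
  by rewrite (cintegralD (cmeasure_conj mu) bcf bcg) Hf Hg (cintegralD mu bf bg) conjD.
- move=> a f bf Hf; under eq_fun do rewrite conjM.
  have bcf := cbounded_measurable_conj bf.
  by rewrite (cintegralZ (cmeasure_conj mu) _ bcf) Hf (cintegralZ mu _ bf) conjM.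
- move=> f_ f M bf fM f_f Hf.
  have := cvgC_conj (cintegral_cvg mu bf fM f_f).
  under eq_fun do rewrite -Hf; apply: cvgC_unique.
  apply: (@cintegral_cvg _ _ _ _ _ _ M).
  + by move=> n; exact: cbounded_measurable_conj.
  + by move=> n x; rewrite normc_conj.
  + by move=> x; exact: (cvgC_conj (f_f x)).
Qed.

(** The hypothesis only concerns values on measurable sets, so that the lemma covers [two_points]
    and also, with [t = 0], a probability that agrees with a Dirac measure there. *)
Lemma cintegral_two_points mu (a b : T) (s t : R[i]) :
  (forall A, measurable A -> mu A = s * (\1_A a)%:C + t * (\1_A b)%:C) ->
  forall f, cbounded_measurable f -> cintegral mu f = s * f a + t * f b.
Proof.
move=> muE; apply: cbounded_measurable_ind.
- by move=> A mA; rewrite cintegral_indic// muE.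
- by move=> f g bf bg Hf Hg; rewrite cintegralD// Hf Hg; ring.
- by move=> c f bf Hf; rewrite cintegralZ// Hf; ring.
- move=> f_ f M bf fM f_f Hf.
  apply: cvgC_unique (cintegral_cvg mu bf fM f_f) _.
  under eq_fun do rewrite Hf; exact: (cvgC_D (cvgC_Ml s (f_f a)) (cvgC_Ml t (f_f b))).
Qed.

End cintegral_examples.

(** * Integrals against product measures *)

Section product_integral.
Context d1 d2 (T1 : measurableType d1) (T2 : measurableType d2) (R : realType).

Lemma cbounded_measurable_fst (f : T1 -> R[i]) : cbounded_measurable f ->
  cbounded_measurable (fun z : T1 * T2 => f z.1).
Proof.
move=> [[mR [M fM]] [mI [N fN]]]; split; split.
- exact: (measurableT_comp mR measurable_fst).
- by exists M => z.
- exact: (measurableT_comp mI measurable_fst).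
- by exists N => z.
Qed.

Lemma cbounded_measurable_snd (f : T2 -> R[i]) : cbounded_measurable f ->
  cbounded_measurable (fun z : T1 * T2 => f z.2).
Proof.
move=> [[mR [M fM]] [mI [N fN]]]; split; split.
- exact: (measurableT_comp mR measurable_snd).
- by exists M => z.
- exact: (measurableT_comp mI measurable_snd).
- by exists N => z.
Qed.

Variables (mu : cmeasure T1 R) (nu : cmeasure T2 R).

(** Fubini for separated variables, by two nested inductions: first [f] is reduced to an indicator,
    then [g], and for two indicators the claim is the value of the product measure on a
    rectangle. *)
Lemma cintegral_prod (f : T1 -> R[i]) (g : T2 -> R[i]) :
  cbounded_measurable f -> cbounded_measurable g ->
  cintegral (cmeasure_prod mu nu) (fun z => f z.1 * g z.2) =
  cintegral mu f * cintegral nu g.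
Proof.
have bprod (f' : T1 -> R[i]) (g' : T2 -> R[i]) :
    cbounded_measurable f' -> cbounded_measurable g' ->
    cbounded_measurable (fun z => f' z.1 * g' z.2).
  move=> bf' bg'; apply: cbounded_measurableM.
    exact: cbounded_measurable_fst.
  exact: cbounded_measurable_snd.
have prod_le (z w : R[i]) (M N : R) : Normc.normc z <= M -> Normc.normc w <= N ->
    Normc.normc (z * w) <= M * N.
  by move=> zM wN; rewrite Normc.normcM ler_pM// normc_ge0.
move=> + bg; move: f; apply: cbounded_measurable_ind.
- move=> A mA; have bA := cbounded_measurable_indic R mA.
  rewrite cintegral_indic//; move: g bg; apply: cbounded_measurable_ind.
  + move=> B mB; rewrite cintegral_indic// -cmeasure_prodX//.
    rewrite -cintegral_indic; last exact: measurableX.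
    congr cintegral; apply/funext => z; rewrite -rmorphM/= !indicE in_setX.
    by case: (_ \in A); case: (_ \in B); rewrite ?(mulr0, mul0r, mulr1).
  + move=> f g bf bg Hf Hg; under eq_fun do rewrite mulrDr.
    rewrite [in RHS]cintegralD// mulrDr -Hf -Hg.
    by rewrite cintegralD//; [exact: bprod bA bf|exact: bprod bA bg].
  + move=> a f bf Hf; under eq_fun do rewrite mulrCA.
    rewrite [in RHS]cintegralZ// mulrCA -Hf.
    by rewrite cintegralZ//; exact: bprod bA bf.
  + move=> f_ f M bf fM f_f Hf.
    have := cvgC_Ml (mu A) (cintegral_cvg nu bf fM f_f).
    under eq_fun do rewrite -Hf; apply: cvgC_unique.
    have [N AN] := cbounded_measurable_bound bA.
    apply: (@cintegral_cvg _ _ _ _ _ _ (N * M)) => [n|n z|z].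
    * exact: bprod bA (bf n).
    * exact: prod_le.
    * exact: (cvgC_Ml _ (f_f z.2)).
- move=> f h bf bh Hf Hh; under eq_fun do rewrite mulrDl.
  rewrite [in RHS]cintegralD// mulrDl -Hf -Hh.
  by rewrite cintegralD//; [exact: bprod bf bg|exact: bprod bh bg].
- move=> a f bf Hf; under eq_fun do rewrite -mulrA.
  rewrite [in RHS]cintegralZ// -mulrA -Hf.
  by rewrite cintegralZ//; exact: bprod bf bg.
- move=> f_ f M bf fM f_f Hf.
  have := cvgC_Ml (cintegral nu g) (cintegral_cvg mu bf fM f_f).
  under eq_fun do rewrite mulrC -Hf; rewrite mulrC; apply: cvgC_unique.
  have [N gN] := cbounded_measurable_bound bg.
  apply: (@cintegral_cvg _ _ _ _ _ _ (M * N)) => [n|n z|z].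
  + exact: bprod (bf n) bg.
  + exact: prod_le.
  + exact: (cvgC_M (v := fun=> g z.2) (f_f z.1) (cvg_cst _)).
Qed.

End product_integral.

(** * The circle *)

Section circle_theory.
Variable R : realType.

Lemma continuous_Re : continuous (@complex.Re R : R[i] -> R).
Proof.
move=> z; apply/(@cvgrPdist_lt _ _ _ _ (@nbhs_filter R[i] z)) => e e0.
(* Balls of [R[i]] have their radius in [R[i]], so [e] is embedded there. *)
have e0' : 0 < e%:C by rewrite ltcR.
have := @nbhsx_ballx R[i] R[i] z _ e0'; apply: filterS => w.
rewrite -ball_normE/= ltcR; apply: le_lt_trans.
by have := ler_Re_normc (z - w); case: z w => [a b] [].
Qed.

Lemma continuous_Im : continuous (@complex.Im R : R[i] -> R).
Proof.
move=> z; apply/(@cvgrPdist_lt _ _ _ _ (@nbhs_filter R[i] z)) => e e0.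
have e0' : 0 < e%:C by rewrite ltcR.
have := @nbhsx_ballx R[i] R[i] z _ e0'; apply: filterS => w.
rewrite -ball_normE/= ltcR; apply: le_lt_trans.
by have := ler_Im_normc (z - w); case: z w => [a b] [].
Qed.

Lemma normc_circle (z : circle R) : Normc.normc (z : R[i]) = 1.
Proof. by case: z => z /= /eqP [] ->. Qed.

Lemma normc_exp_circle (z : circle R) n : Normc.normc ((z : R[i]) ^+ n) = 1.
Proof.
elim: n => [|n IHn]; first by rewrite expr0 Normc.normc1.
by rewrite exprS Normc.normcM normc_circle mul1r.
Qed.

(** Open rays generate the Borel sets of the line, and their preimages are open in the circle, hence
    among the generators of its sigma-algebra. *)
Lemma measurable_circle_comp (h : R[i] -> R) : continuous h ->
  measurable_fun setT (fun z : circle R => h z).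
Proof.
move=> ch; apply: (measurability _ (RGenOInfty.measurableE R)) => //.
move=> _ [_ [x ->] <-]; rewrite setTI; apply: sub_sigma_algebra.
have cval : continuous (@circle_val R : circle R -> R[i]) by exact: initial_continuous.
have /continuousP : continuous (fun z : circle R => h z).
  by move=> z; apply: continuous_comp; [exact: cval|exact: ch].
by apply; exact: interval_open.
Qed.

Lemma cbounded_measurable_circle :
  cbounded_measurable (fun z : circle R => z : R[i]).
Proof.
split; split.
- exact: measurable_circle_comp continuous_Re.
- by exists 1 => z; rewrite (le_trans (ler_Re_normc _))// normc_circle.
- exact: measurable_circle_comp continuous_Im.
- by exists 1 => z; rewrite (le_trans (ler_Im_normc _))// normc_circle.
Qed.

Lemma measurable_circle1 (a : circle R) : measurable [set a].
Proof.
(* A point is cut out by its two coordinates, which are measurable functions. *)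
have -> : [set a] = (fun z : circle R => complex.Re z) @^-1` [set complex.Re a] `&`
    (fun z : circle R => complex.Im z) @^-1` [set complex.Im a].
  apply/seteqP; split => [_ -> //|z /= [zR zI]]; apply: val_inj; apply/eqP.
  by rewrite eq_complex zR zI !eqxx.
have [[mR _] [mI _]] := cbounded_measurable_circle.
apply: measurableI; rewrite -[X in measurable X]setTI.
  exact: mR.
exact: mI.
Qed.

Lemma circle_div_subproof (z w : circle R) : `|(z : R[i]) * (w : R[i])^*| == 1.
Proof.
by rewrite normrM norm_conjC; case: z w => [z /eqP zz] [w /eqP ww] /=; rewrite zz ww mulr1.
Qed.

(** On the circle the conjugate is the inverse, so this is the quotient of [z] by [w]. As an element
    of [circle R] it can be fed to the hypotheses [good] and [ergodic]. *)
Definition circle_div (z w : circle R) : circle R :=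
  Circle (circle_div_subproof z w).

Lemma circle_div_eq1 (z w : circle R) : (circle_div z w == 1 :> R[i]) = (z == w).
Proof.
have ww : (w : R[i])^* * w = 1 by rewrite mulrC -normc_sqr normc_circle expr1n.
rewrite /= -(inj_eq val_inj) /=; apply/eqP/eqP => [zw|->]; last by rewrite mulrC.
by rewrite -[RHS]mul1r -zw -mulrA ww mulr1.
Qed.

End circle_theory.

(** * Cesaro means *)

Section cesaro_theory.
Variable R : realType.
Implicit Types u : nat -> R[i].

Lemma normc_cesaro_le u N : (forall n, Normc.normc (u n) <= 1) ->
  Normc.normc (Defs.cesaro u N) <= 1.
Proof.
move=> u1.
have sum_le : Normc.normc (\sum_(1 <= n < N.+1) u n) <= N%:R.
  elim: N => [|N IHN]; first by rewrite big_geq// Normc.normc0.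
  rewrite big_nat_recr//= (le_trans (normc_leD _ _))//.
  by rewrite -natr1 lerD.
rewrite /Defs.cesaro Normc.normcM Normc.normcV.
have -> : Normc.normc (N%:R : R[i]) = N%:R.
  by rewrite -(rmorph_nat (@real_complex R)) normc_ReIm /= expr0n addr0 sqrtr_sqr ger0_norm.
(* The mean at index 0 is 0, because the inverse of 0 is 0. *)
case: N sum_le => [|N] sum_le; first by rewrite invr0 mul0r.
by rewrite mulrC ler_pdivrMr// mul1r.
Qed.

(** The index is a successor because the mean at 0 is 0 whatever [a] is. *)
Lemma cesaro_const (K : numFieldType) (a : K) N : Defs.cesaro (fun=> a) N.+1 = a.
Proof.
by rewrite /Defs.cesaro sumr_const_nat subSS subn0 -[a *+ _]mulr_natl mulKf// pnatr_eq0.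
Qed.

Lemma cesaro_real (u : nat -> R) N : (Defs.cesaro u N)%:C = Defs.cesaro (fun n => (u n)%:C) N.
Proof. by rewrite /Defs.cesaro rmorphM/= fmorphV/= rmorph_nat rmorph_sum. Qed.

(** With [u n] equal to [l ^+ k n], the left-hand terms are the squared Fourier coefficients of the
    measure with mass 1 at 1 and mass [t], of modulus 1, at [l]. *)
Lemma cesaro_affine (t : R[i]) u N :
  Defs.cesaro (fun n => 2 + 2 * complex.Re (t * u n)) N.+1 =
  2 + 2 * complex.Re (t * Defs.cesaro u N.+1).
Proof.
have ReE (v : nat -> R[i]) :
    complex.Re (Defs.cesaro v N.+1) = Defs.cesaro (fun n => complex.Re (v n)) N.+1.
  have NE : (N.+1%:R^-1 : R[i]) = (N.+1%:R^-1)%:C by rewrite fmorphV/= rmorph_nat.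
  rewrite /Defs.cesaro NE Re_mul /= mul0r subr0; congr (_ * _).
  exact: (big_morph _ (@Re_add R)).
transitivity (Defs.cesaro (fun=> 2 : R) N.+1 +
    2 * Defs.cesaro (fun n => complex.Re (t * u n)) N.+1).
  by rewrite /Defs.cesaro big_split/= mulrDr -mulr_sumr [2 * (_ * _)]mulrCA.
rewrite cesaro_const -ReE; congr (_ + _ * complex.Re _).
by rewrite /Defs.cesaro mulrCA -mulr_sumr.
Qed.

End cesaro_theory.

(** * Wiener means along a good sequence *)

Section good_sequences.
Variables (R : realType) (k : nat -> nat).
Hypothesis hk : good R k.

Lemma limit_function_cvg (l : circle R) :
  Defs.cesaro (fun n => (l : R[i]) ^+ k n) @ \oo --> limit_function k (l : R[i]).
Proof. by case: hk => _ /(_ l). Qed.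

Lemma normc_cesaro_power_le (l : circle R) N :
  Normc.normc (Defs.cesaro (fun n => (l : R[i]) ^+ k n) N) <= 1.
Proof.
by apply: normc_cesaro_le => n; rewrite normc_exp_circle.
Qed.

Lemma cbounded_measurable_circle_div :
  cbounded_measurable (fun z : circle R * circle R => circle_div z.1 z.2 : R[i]).
Proof.
apply: cbounded_measurableM.
  exact: cbounded_measurable_fst (@cbounded_measurable_circle R).
apply: cbounded_measurable_conj.
exact: cbounded_measurable_snd (@cbounded_measurable_circle R).
Qed.

Lemma cbounded_measurable_cesaro N :
  cbounded_measurable (fun z : circle R * circle R =>
    Defs.cesaro (fun n => (circle_div z.1 z.2 : R[i]) ^+ k n) N).
Proof.
apply: cbounded_measurableM; first exact: cbounded_measurable_cst.
apply: cbounded_measurable_sum => n; apply: cbounded_measurableX.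
exact: cbounded_measurable_circle_div.
Qed.

Variable mu : cmeasure (circle R) R.

(** The squared modulus is the coefficient times its conjugate; the latter is an integral against
    the conjugate measure, and [cintegral_prod] merges the two factors. *)
Lemma normc_fourier_sqr n : (Normc.normc (fourier mu n) ^+ 2)%:C =
  cintegral (cmeasure_prod mu (cmeasure_conj mu))
    (fun z => (circle_div z.1 z.2 : R[i]) ^+ n).
Proof.
have bX := cbounded_measurableX n (@cbounded_measurable_circle R).
have := cintegral_prod mu (cmeasure_conj mu) bX (cbounded_measurable_conj bX).
rewrite cintegral_conj// => prodE; rewrite normc_sqr; apply: etrans (esym prodE) _.
by congr cintegral; apply/funext => z /=; rewrite exprMn rmorphXn.
Qed.

(** By linearity the Wiener mean is the integral of the Cesaro means of the powers of the quotient.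
    These are bounded by 1, so bounded convergence applies. *)
Lemma wiener_mean_cvg : (wiener_mean k mu N)%:C @[N --> \oo] -->
  cintegral (cmeasure_prod mu (cmeasure_conj mu))
    (fun z => limit_function k ((z.1 : R[i]) * (z.2 : R[i])^*)).
Proof.
have wE N : (wiener_mean k mu N)%:C = cintegral (cmeasure_prod mu (cmeasure_conj mu))
    (fun z => Defs.cesaro (fun n => (circle_div z.1 z.2 : R[i]) ^+ k n) N).
  have bX n := cbounded_measurableX (k n) cbounded_measurable_circle_div.
  rewrite /wiener_mean cesaro_real /Defs.cesaro cintegralZ; last exact: cbounded_measurable_sum.
  rewrite cintegral_sum//; congr (_ * _).
  by apply: eq_bigr => n _; rewrite normc_fourier_sqr.
under eq_fun do rewrite wE.
apply: cintegral_cvg cbounded_measurable_cesaro _ _.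
  by move=> n z; exact: normc_cesaro_power_le.
(* The quotient lies on the circle, so goodness gives the pointwise limit. *)
by move=> z; exact: (@limit_function_cvg (circle_div z.1 z.2)).
Qed.

End good_sequences.

(** * Atoms and the diagonal *)

Section atomic_part.
Variables (R : realType) (mu : cmeasure (circle R) R).

(** Infinitely many such points would contain an injective sequence; sigma-additivity on its
    disjoint singletons makes the series of masses converge, so the masses tend to 0 and cannot stay
    at least [e] in modulus. *)
Lemma finite_large_atoms (e : R) : 0 < e ->
  finite_set [set a | e <= Normc.normc (mu [set a])].
Proof.
move=> e0; apply: contrapT => /infiniteP/pcard_leP[f].
have fe n : e <= Normc.normc (mu [set f n]) by exact: (@funS _ _ _ _ f n I).
have tF : trivIset setT (fun n => [set f n]).
  by move=> i j _ _ [x [/= -> fij]]; apply: 'inj_f => //; rewrite inE.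
have mF n : measurable [set f n] by exact: measurable_circle1.
have /cvg_complexP[cR cI] := cmeasure_sigma_additive mu mF tF.
(* Half of [e] for each coordinate, as the modulus is at most the sum of their absolute values. *)
have e20 : 0 < e / 2 by rewrite divr_gt0.
have R0 : complex.Re (mu [set f n]) @[n --> \oo] --> 0.
  apply: cvg_series_cvg_0; apply/cvg_ex; eexists; move: cR.
  by under eq_fun do rewrite Re_sum; exact.
have I0 : complex.Im (mu [set f n]) @[n --> \oo] --> 0.
  apply: cvg_series_cvg_0; apply/cvg_ex; eexists; move: cI.
  by under eq_fun do rewrite Im_sum; exact.
have [n [nR nI]] : exists n, `|complex.Re (mu [set f n])| < e / 2 /\
    `|complex.Im (mu [set f n])| < e / 2.
  have HR : \forall n \near \oo, `|complex.Re (mu [set f n])| < e / 2.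
    exact: cvgr0_norm_lt.
  have HI : \forall n \near \oo, `|complex.Im (mu [set f n])| < e / 2.
    exact: cvgr0_norm_lt.
  by have [n [? ?]] := filter_ex (filterI HR HI); exists n.
have := le_lt_trans (normc_le_ReIm _) (ltrD nR nI).
by rewrite -splitr ltNge fe.
Qed.

(** Every atom has mass at least [1/(n+1)] in modulus for some [n], and for each [n] there are
    finitely many of these. *)
Lemma countable_atoms : countable (atoms mu).
Proof.
apply: (@sub_countable _ _ _ (\bigcup_n [set a | n.+1%:R^-1 <= Normc.normc (mu [set a])])).
  apply: subset_card_le => a /= mua0.
  have mua : 0 < Normc.normc (mu [set a]).
    rewrite lt_def normc_ge0 andbT; apply: contra mua0 => /eqP /Normc.eq0_normc ->.
    exact: eqxx.
  have [n] := ltr_add_invr mua; rewrite add0r => /ltW ?; by exists n.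
apply: bigcup_countable => // n _; apply: finite_set_countable.
by apply: finite_large_atoms; rewrite invr_gt0.
Qed.

(** The diagonal is the set where the quotient equals 1, and the quotient is measurable for the
    product sigma-algebra. *)
Lemma measurable_circle_diagonal : measurable [set z : circle R * circle R | z.1 = z.2].
Proof.
pose w (z : circle R * circle R) : R[i] := circle_div z.1 z.2.
have -> : [set z : circle R * circle R | z.1 = z.2] =
    (fun z => complex.Re (w z)) @^-1` [set 1] `&`
    (fun z => complex.Im (w z)) @^-1` [set 0].
  apply/seteqP; split => z /=.
    by move=> /eqP; rewrite -circle_div_eq1 eq_complex => /andP[/eqP ? /eqP ?].
  by move=> [zR zI]; apply/eqP; rewrite -circle_div_eq1 eq_complex; apply/andP; split; apply/eqP.
have [[mR _] [mI _]] := cbounded_measurable_circle_div R.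
apply: measurableI; rewrite -[X in measurable X]setTI.
  exact: mR.
exact: mI.
Qed.

Lemma xsection_diagonal (x : circle R) :
  xsection [set z : circle R * circle R | z.1 = z.2] x = [set x].
Proof. by apply/seteqP; split => y; rewrite /xsection /= inE. Qed.

(** The singleton of [x] is the section of the diagonal at [x], and measures of sections of a
    measurable set depend measurably on the point. *)
Lemma cbounded_measurable_atomic_part :
  cbounded_measurable (fun x : circle R => (mu [set x])^*).
Proof.
apply: cbounded_measurable_conj; split; under eq_fun do rewrite -xsection_diagonal.
  exact: (bounded_measurable_charge_xsection (charge_re mu) measurable_circle_diagonal).
exact: (bounded_measurable_charge_xsection (charge_im mu) measurable_circle_diagonal).
Qed.

(** The integrand is the indicator of the diagonal, and the product measure integrates the measures
    of the sections, here singletons. *)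
Lemma cintegral_diagonal :
  cintegral (cmeasure_prod mu (cmeasure_conj mu))
    (fun z => (circle_div z.1 z.2 == 1 :> R[i])%:R) =
  cintegral mu (fun x => (mu [set x])^*).
Proof.
transitivity (cintegral (cmeasure_prod mu (cmeasure_conj mu))
   (fun z => (\1_[set z : circle R * circle R | z.1 = z.2] z)%:C)).
  congr cintegral; apply/funext => z; rewrite circle_div_eq1 indicE rmorph_nat.
  by congr (_ %:R); congr nat_of_bool; apply/eqP/idP; rewrite inE.
rewrite cintegral_indic; last exact: measurable_circle_diagonal.
rewrite /= /cmeasure_prod_fun; congr cintegral; apply/funext => x.
by rewrite xsection_diagonal.
Qed.

(** The function integrated on the right vanishes off the countable set of atoms, so it is a
    pointwise limit of finite combinations of indicators of atoms. Their integrals are the partial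
    sums of the left-hand side, and bounded convergence concludes. *)
Lemma esum_atoms :
  (\esum_(a in atoms mu) (Normc.normc (mu [set a]) ^+ 2)%:E)%E =
  (complex.Re (cintegral mu (fun x => (mu [set x])^*)))%:E.
Proof.
(* The atoms are enumerated by a subset [B] of the naturals, finite or not; terms with index outside
   [B] are set to 0. *)
have /countable_bijP[B /card_esym/card_set_bijP[f fB]] := countable_atoms.
have [fS fI fJ] := fB.
pose t i : R := if i \in B then Normc.normc (mu [set f i]) ^+ 2 else 0.
rewrite (reindex_esum _ _ _ _ fB) esum_mkcond -nneseries_esumT; last first.
  by move=> n; case: ifP => // _; rewrite lee_fin sqr_ge0.
apply/cvg_lim => //.
rewrite (_ : (fun n => _) = (fun n => (\sum_(0 <= i < n) t i)%:E)); last first.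
  by apply/funext => n; rewrite -sumEFin; apply: eq_bigr => i _; rewrite /t; case: ifP.
apply: cvg_EFin; first exact: nearW.
pose F i x : R[i] := (if i \in B then (mu [set f i])^* else 0) * (\1_[set f i] x)%:C.
have bF i : cbounded_measurable (F i).
  apply: cbounded_measurableM; first exact: cbounded_measurable_cst.
  by apply: cbounded_measurable_indic; exact: measurable_circle1.
have Fint n : cintegral mu (fun x => \sum_(0 <= i < n) F i x) =
    (\sum_(0 <= i < n) t i)%:C.
  rewrite cintegral_sum// rmorph_sum; apply: eq_bigr => i _ /=.
  have mf := measurable_circle1 (f i).
  rewrite cintegralZ; last exact: cbounded_measurable_indic.
  rewrite cintegral_indic// /t; case: ifP => _; last by rewrite mul0r.
  by rewrite normc_sqr mulrC.
(* By injectivity of the enumeration, only the term of index [j] is nonzero at the atom [x], so the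
   partial sums are bounded by [M] and are exact from [j.+1] on. *)
have F_at j x : B j -> f j = x -> forall n, \sum_(0 <= i < n) F i x =
    if (j < n)%N then (mu [set x])^* else 0.
  move=> Bj fj n; transitivity (\sum_(0 <= i < n | i == j) (mu [set x])^*).
    rewrite [RHS]big_mkcond; apply: eq_bigr => i _ /=; rewrite /F indicE classical_sets.in_set1.
    case: (i =P j) => [->|ij]; first by rewrite mem_set// fj eqxx mulr1.
    case: ifPn; last by rewrite mul0r.
    rewrite inE => Bi; case: eqP => [xfi|]; last by rewrite mulr0.
    by case: ij; apply: fI; rewrite ?inE// -xfi.
  by rewrite big_nat1_eq.
have F_out x : ~ atoms mu x -> forall n, \sum_(0 <= i < n) F i x = 0.
  move=> nx n; apply: big1_seq => i _; rewrite /F indicE classical_sets.in_set1.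
  case: ifPn; last by rewrite mul0r.
  rewrite inE => Bi; case: eqP => [xfi|]; last by rewrite mulr0.
  by case: nx; rewrite xfi; exact: fS.
have [M gM] := cbounded_measurable_bound cbounded_measurable_atomic_part.
have M0 : 0 <= M by rewrite (le_trans (normc_ge0 _) (gM point)).
suff /cvg_complexP[H _] : cintegral mu (fun x => \sum_(0 <= i < n) F i x) @[n --> \oo] -->
    cintegral mu (fun x => (mu [set x])^*).
  by move: H; under eq_fun do rewrite Fint /=.
apply: (@cintegral_cvg _ _ _ mu _ _ M).
- by move=> n; exact: cbounded_measurable_sum.
- move=> n x; have [ax|nax] := pselect (atoms mu x).
    have [j Bj fj] := fJ _ ax.
    by rewrite (F_at j)//; case: ifP => _; rewrite ?Normc.normc0// gM.
  by rewrite F_out// Normc.normc0.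
- move=> x; have [ax|nax] := pselect (atoms mu x).
    have [j Bj fj] := fJ _ ax.
    apply: cvg_near_cst; exists j.+1 => // n /= jn.
    by rewrite (F_at j)// jn.
  apply: cvg_near_cst; apply: nearW => n; rewrite F_out//.
  by move: nax => /negP; rewrite negbK => /eqP ->; rewrite conjc0.
Qed.

End atomic_part.

(** * Ergodic sequences *)

Section two_points.
Context d (T : measurableType d) (R : realType).
Variables (a b : T) (s t : R[i]).

Let two_points_fun (A : set T) : R[i] :=
  s * cmeasure_of_measure (\d_a : probability T R) A +
  t * cmeasure_of_measure (\d_b : probability T R) A.

Let two_points_sigma_additive (F : nat -> set T) :
  (forall i, measurable (F i)) -> trivIset setT F ->
  (fun n => \sum_(0 <= i < n) two_points_fun (F i)) @ \oo -->
    two_points_fun (\bigcup_i F i).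
Proof.
move=> mF tF; under eq_fun do rewrite big_split/= -!mulr_sumr.
exact: (cvgC_D
  (cvgC_Ml s (cmeasure_sigma_additive (cmeasure_of_measure (\d_a : probability T R)) mF tF))
  (cvgC_Ml t (cmeasure_sigma_additive (cmeasure_of_measure (\d_b : probability T R)) mF tF))).
Qed.

(** The measure with masses [s] at [a] and [t] at [b], used as test measure for the converse in
    (b). *)
Definition two_points : cmeasure T R := CMeasure two_points_sigma_additive.

Lemma two_pointsE A : two_points A = s * (\1_A a)%:C + t * (\1_A b)%:C.
Proof. by []. Qed.

End two_points.

Section ergodic_sequences.
Variables (R : realType) (k : nat -> nat).
Hypothesis hk : good R k.

Lemma wiener_mean_Re (mu : cmeasure (circle R) R) : wiener_mean k mu N @[N --> \oo] -->
  complex.Re (cintegral (cmeasure_prod mu (cmeasure_conj mu))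
    (fun z => limit_function k ((z.1 : R[i]) * (z.2 : R[i])^*))).
Proof. by have /cvg_complexP[] := @wiener_mean_cvg _ _ hk mu. Qed.

(** Ergodicity turns the limit function at the quotient into the indicator of the diagonal, whose
    integral is the sum over the atoms. *)
Lemma ergodic_wiener (mu : cmeasure (circle R) R) : ergodic R k ->
  (wiener_mean k mu N)%:E @[N --> \oo] -->
    (\esum_(a in atoms mu) (Normc.normc (mu [set a]) ^+ 2)%:E)%E.
Proof.
move=> [_ erg]; rewrite esum_atoms -cintegral_diagonal.
apply: cvg_EFin; first exact: nearW.
have -> : (fun z => (circle_div z.1 z.2 == 1 :> R[i])%:R) =
    (fun z : circle R * circle R => limit_function k ((z.1 : R[i]) * (z.2 : R[i])^*)).
  by apply/funext => z; rewrite -(erg (circle_div z.1 z.2)).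
exact: wiener_mean_Re.
Qed.

Lemma limit_function1 : limit_function k (1 : R[i]) = 1.
Proof.
apply: cvgC_unique (@limit_function_cvg _ _ hk (circle1 R)) _ => /=.
have cE N : Defs.cesaro (fun n => (1 : R[i]) ^+ k n) N.+1 = 1.
  rewrite -[RHS](cesaro_const (1 : R[i]) N); congr Defs.cesaro.
  by apply/funext => n; rewrite expr1n.
(* The shift discards the mean at 0, which is 0 instead of 1. *)
by rewrite -cvg_shiftS; under eq_fun do rewrite cE; exact: cvg_cst.
Qed.

(** The Wiener means tend to [2 + 2 Re (t c(l))], where [c] is the limit function, while the assumed
    limit is the sum of the squared masses, [1 + t t^* = 2]. *)
Lemma wiener_two_points (l : circle R) (t : R[i])
    (mu := two_points (circle1 R) l 1 t) : l != circle1 R -> t * t^* = 1 ->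
  (wiener_mean k mu N)%:E @[N --> \oo] -->
    (\esum_(a in atoms mu) (Normc.normc (mu [set a]) ^+ 2)%:E)%E ->
  complex.Re (t * limit_function k (l : R[i])) = 0.
Proof.
move=> l1 tt; rewrite esum_atoms.
have muint := @cintegral_two_points _ _ _ mu _ _ _ _ (fun A _ => two_pointsE _ _ _ _ A).
rewrite (muint _ (cbounded_measurable_atomic_part mu)).
(* As [l] differs from 1, the two masses do not add up at one point. *)
have -> : mu [set circle1 R] = 1.
  rewrite two_pointsE !indicE !classical_sets.in_set1 eqxx (negbTE l1).
  by rewrite mulr1 mulr0 addr0.
have -> : mu [set l] = t.
  rewrite two_pointsE !indicE !classical_sets.in_set1 eqxx eq_sym (negbTE l1).
  by rewrite mulr1 mulr0 add0r.
rewrite conjc1 mulr1 tt => /fine_cvgP[_ /= H].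
have wE N : wiener_mean k mu N.+1 =
    2 + 2 * complex.Re (t * Defs.cesaro (fun n => (l : R[i]) ^+ k n) N.+1).
  rewrite -cesaro_affine; congr Defs.cesaro; apply/funext => n.
  rewrite /fourier muint; last first.
    by apply: cbounded_measurableX; exact: cbounded_measurable_circle.
  rewrite /= expr1n mul1r normc_sqr_add1// Normc.normcM normc_exp_circle mulr1.
  have [//|] := eqVneq (Normc.normc t) 1.
  rewrite -(eqrXn2 (n := 2) _ (normc_ge0 t) ler01)// expr1n -(inj_eq (@complexI R)).
  by rewrite normc_sqr tt eqxx.
move: H; rewrite -cvg_shiftS /=; under eq_fun do rewrite wE.
have /cvg_complexP[+ _] := cvgC_Ml t (@limit_function_cvg _ _ hk l).
rewrite -cvg_shiftS /= => H1 H2.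
have H3 : 2 + 2 * complex.Re (t * Defs.cesaro (fun n => (l : R[i]) ^+ k n) n.+1) @[n --> \oo] -->
   2 + 2 * complex.Re (t * limit_function k (l : R[i])).
  by apply: cvgD; [exact: cvg_cst|apply: cvgM => //; exact: cvg_cst].
have /eqP : 2 + 2 * complex.Re (t * limit_function k (l : R[i])) = 2.
  exact: cvg_unique H3 H2.
by rewrite -subr_eq0 addrAC subrr add0r mulf_eq0 pnatr_eq0 => /eqP.
Qed.

Lemma wiener_ergodic :
  (forall mu : cmeasure (circle R) R, (wiener_mean k mu N)%:E @[N --> \oo] -->
    (\esum_(a in atoms mu) (Normc.normc (mu [set a]) ^+ 2)%:E)%E) ->
  ergodic R k.
Proof.
move=> W; split=> // l.
have [l1|l1] := eqVneq l (circle1 R); first by rewrite l1 eqxx limit_function1.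
have -> : (l == 1 :> R[i]) = false by apply/negP => /eqP ll; case/eqP: l1; apply: val_inj.
apply/eqP; rewrite eq_complex /=; apply/andP; split; apply/eqP.
  have tt : 1 * (1 : R[i])^* = 1 by rewrite mul1r; exact: rmorph1.
  by have := wiener_two_points l1 tt (W _); rewrite mul1r.
(* With [t = -i], the real part of [t w] is the imaginary part of [w]. *)
have tt : (0 +i* (-1)) * (0 +i* (-1) : R[i])^* = 1.
  by apply/eqP; rewrite eq_complex /=; apply/andP; split; apply/eqP; ring.
have := wiener_two_points l1 tt (W _); rewrite Re_mul /=.
by rewrite mul0r sub0r mulN1r opprK.
Qed.

Lemma dirac_wiener (P : probability (circle R) R) (a : circle R) :
  (forall A, measurable A -> P A = \d_a A) ->
  wiener_mean k (cmeasure_of_measure P) N @[N --> \oo] --> (1 : R).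
Proof.
move=> Pa; set mu := cmeasure_of_measure P.
(* A Dirac measure is treated as a two-point measure with second mass 0. *)
have muE A : measurable A -> mu A = 1 * (\1_A a)%:C + 0 * (\1_A a)%:C.
  by move=> mA; rewrite /= Pa// diracE indicE mul1r mul0r addr0.
rewrite -cvg_shiftS.
have wE N : wiener_mean k mu N.+1 = 1.
  rewrite -[RHS](cesaro_const (1 : R) N); congr Defs.cesaro; apply/funext => n.
  rewrite /fourier (cintegral_two_points muE); last first.
    by apply: cbounded_measurableX; exact: cbounded_measurable_circle.
  rewrite mul1r mul0r addr0; by rewrite normc_exp_circle expr1n.
by under eq_fun do rewrite wE; exact: cvg_cst.
Qed.

Lemma wiener_dirac (P : probability (circle R) R) : ergodic R k ->
  wiener_mean k (cmeasure_of_measure P) N @[N --> \oo] --> (1 : R) ->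
  exists a : circle R, forall A, measurable A -> P A = \d_a A.
Proof.
move=> erg w1; set mu := cmeasure_of_measure P.
have m1 := @measurable_circle1 R.
have fP A : measurable A -> P A \is a fin_num by exact: fin_num_measure.
pose p a : R := fine (P [set a]).
have p0 a : 0 <= p a by rewrite fine_ge0.
have p1 a : p a <= 1 by rewrite -lee_fin fineK ?fP// probability_le1.
have muE a : Normc.normc (mu [set a]) ^+ 2 = p a ^+ 2.
  by rewrite normc_sqr_ReIm /= [0 ^+ 2]expr0n addr0.
(* Uniqueness of the limit: the Wiener means tend both to 1 and to the sum of the squared masses. *)
have e1 : (\esum_(a in atoms mu) (p a ^+ 2)%:E = 1)%E.
  under eq_esum do rewrite -muE.
  apply: cvg_unique (@ergodic_wiener mu erg) _ => //.
  by apply: cvg_EFin => //; exact: nearW.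
(* Each finite partial sum is the probability of a finite set. *)
have sum1 : (\esum_(a in atoms mu) (p a)%:E <= 1)%E.
  apply: ge_ereal_sup => _ [X [finX _] <-].
  rewrite (eq_fsbigr (fun a => P [set a])); last by move=> x _; rewrite fineK// fP.
  rewrite -measure_fin_bigcup//; last by move=> i j _ _ [x [-> ->]].
  apply: probability_le1; apply: fin_bigcup_measurable => //.
have d0 a : (0 <= (p a - p a ^+ 2)%:E)%E by rewrite lee_fin subr_ge0 expr2 ler_piMl.
have diff0 : (\esum_(a in atoms mu) (p a - p a ^+ 2)%:E <= 0)%E.
  (* Replacing 1 on the left by the sum of the [p a ^+ 2] leaves the sum of the [p a]. *)
  have : (1 + \esum_(a in atoms mu) (p a - p a ^+ 2)%:E <= 1)%E.
    rewrite -{1}e1 -esumD//; last by move=> a _; rewrite lee_fin sqr_ge0.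
    by under eq_esum do rewrite -EFinD addrC subrK.
  by rewrite -{2}[1%E]adde0 leeD2lE.
(* Without atoms the sum of the squares would be 0 and not 1. *)
have [a aa] : exists a, atoms mu a.
  apply: contrapT => na; have A0 : atoms mu = set0.
    by apply/seteqP; split => // x ax; apply: na; exists x.
  by move: e1; rewrite A0 esum_set0 => /eqP; rewrite eqe eq_sym oner_eq0.
have pa : p a = 1.
  (* A single nonnegative term is at most the whole sum; dividing [p a <= p a ^+ 2] by [p a > 0]
     then gives [1 <= p a]. *)
  have : ((p a - p a ^+ 2)%:E <= 0)%E.
    apply: le_trans diff0; apply: esum_ge; exists [set a]; last by rewrite fsbig_set1.
    by split => // _ ->.
  rewrite lee_fin subr_le0 => pp.
  have pa0 : 0 < p a.
    rewrite lt_def p0 andbT; apply: contra aa => /eqP pa0.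
    by rewrite /mu /= -/(p a) pa0.
  apply/eqP; rewrite eq_le p1 /=.
  by rewrite -(ler_pM2l pa0) mulr1 -expr2.
have Pa : P [set a] = 1%E by rewrite -[LHS]fineK ?fP// -/(p a) pa.
(* A set containing [a] has probability between that of the singleton and 1; any other set lies in
   the complement of the singleton, which is null. *)
exists a => A mA; rewrite diracE; have [aA|aA] := boolP (a \in A).
  apply/eqP; rewrite eq_le probability_le1//= -Pa le_measure ?inE//.
  by move=> _ ->; rewrite inE in aA.
have PC : P (~` [set a]) = 0%E by rewrite probability_setC// Pa subee.
have PA : (P A <= 0)%E.
  rewrite -PC; apply: le_measure; rewrite ?inE//; first exact: measurableC.
  by move=> x Ax xa; apply: (negP aA); rewrite -xa; exact: mem_set.
by apply/eqP; rewrite eq_le PA measure_ge0.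
Qed.

End ergodic_sequences.

Theorem proposition2p6 (R : realType) (k : nat -> nat) (hk : good R k) :
  [/\ forall mu : cmeasure (circle R) R,
        (wiener_mean k mu N)%:C @[N --> \oo] -->
        cintegral (cmeasure_prod mu (cmeasure_conj mu))
          (fun z => limit_function k ((z.1 : R[i]) * (z.2 : R[i])^*)),
      ergodic R k <->
      (forall mu : cmeasure (circle R) R,
        (wiener_mean k mu N)%:E @[N --> \oo] -->
        \esum_(a in atoms mu) (Normc.normc (mu [set a]) ^+ 2)%:E) &
      ergodic R k ->
      forall P : probability (circle R) R,
        wiener_mean k (cmeasure_of_measure P) N @[N --> \oo] --> (1 : R) <->
        exists a : circle R, forall A, measurable A -> P A = \d_a A].
Proof.
split.
- exact: wiener_mean_cvg.
- by split => [erg mu|]; [exact: ergodic_wiener|exact: wiener_ergodic].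
- by move=> erg P; split => [|[a]]; [exact: wiener_dirac|exact: dirac_wiener].
Qed.
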